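(* Let $\mathbb{F}$ be a field, let $M=(X^*,I)$ be any pc monoid with $|X|=n$, and let $A$ be an $\mathbb{F}$-weighted automaton of size $s$ over $M$ computing a series $S$. Then $S$ is nonzero if and only if there exists a word $w\in X^*$ of length $O(n^3s^2)$ such that $[w]S\neq 0$.
   Context: A pc monoid $M=(X^*,I)$ has finite alphabet $X$ and symmetric reflexive $I\subseteq X\times X$; its elements are classes of $X^*$ modulo the congruence generated by $xy=yx$ for $(x,y)\in I$. An $\mathbb{F}$-weighted automaton over $M$ is a tuple $(Q,\iota,E,\tau)$ with $\iota,\tau:Q\to\mathbb{F}$, $E:Q\times X\times Q\to\mathbb{F}$, of size $|Q|$. The series $S$ it computes assigns to each $m\in M$ (and to each word $w\in X^*$, via its class) the coefficient $[m]S=\sum \iota(q_0)E(q_0,a_1,q_1)\cdots E(q_{t-1},a_t,q_t)\tau(q_t)$, the sum over all paths whose label word $a_1\cdots a_t$ lies in the class $m$. $S$ is nonzero if some coefficient is nonzero. *)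

(* Defs.v *)
From mathcomp Require Import all_boot all_algebra.
From Stdlib Require Import Relations ClassicalDescription.
Set Implicit Arguments. Unset Strict Implicit. Unset Printing Implicit Defensive.
Import GRing.Theory.
Local Open Scope ring_scope.

Section PC.
Variable X : finType.

Definition swap_step (I : rel X) (u v : seq X) : Prop :=
  exists (p q : seq X) (x y : X), I x y /\ u = p ++ x :: y :: q /\ v = p ++ y :: x :: q.

(* The congruence on X^* generated by xy = yx for (x,y) in I
   (equivalence closure of elementary commutations; it is automatically
   compatible with concatenation). *)
Definition trace_eq (I : rel X) : relation (seq X) :=
  clos_refl_sym_trans (seq X) (swap_step I).

Definition trace_eqb (I : rel X) (u v : seq X) : bool :=
  if excluded_middle_informative (trace_eq I u v) then true else false.

Variables (F : fieldType) (Q : finType)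
          (iota : Q -> F) (E : Q -> X -> Q -> F) (tau : Q -> F).

Definition path_weight (w : seq X) (q : {ffun 'I_(size w).+1 -> Q}) : F :=
  iota (q ord0)
  * (\prod_(i < size w)
       E (q (widen_ord (leqnSn _) i)) (tnth (in_tuple w) i) (q (lift ord0 i)))
  * tau (q ord_max).

Definition word_weight (w : seq X) : F :=
  \sum_(q : {ffun 'I_(size w).+1 -> Q}) path_weight q.

(* [w]S : sum over all paths whose label lies in the class of w.
   Every word in the class of w has length size w, so this ranges over
   the words u of length size w that are trace-equivalent to w. *)
Definition series_coef (I : rel X) (w : seq X) : F :=
  \sum_(u : (size w).-tuple X | trace_eqb I w u) word_weight u.

End PC.

(* Main.v *)
(* A trace is determined by the projections of its words to pairs of
   non-commuting letters, so the trace monoid embeds into a finite power Y of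
   the monoid of affine maps x |-> u + 2 ^ v * x with u, v natural numbers.
   The monoid algebra F[Y] has no zero divisors, by unique products, and it
   contains elements c_0, ..., c_s, not all zero, with \sum_i c_i a M^i = 0 for
   an automaton of size s with initial vector a and transition matrix M:
   coefficients supported in a large box have more degrees of freedom than
   there are constraints.  If j is the last index with c_j <> 0, then
   c_j a M^k b = - \sum_(i < j) c_i a M^(i + k - j) b, so the vanishing of the
   series on shorter words propagates to every length k >= s.  A nonzero series
   is therefore nonzero on a word of length less than s. *)
From Stdlib Require Import Relations ClassicalDescription.
Require Import Defs.
From mathcomp Require Import all_boot all_algebra.
From mathcomp Require Import zify.
Set Implicit Arguments. Unset Strict Implicit. Unset Printing Implicit Defensive.
Import GRing.Theory.
Local Open Scope ring_scope.

(** * Size estimates for boxes *)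

Section Counting.
Local Open Scope nat_scope.

(** Bernoulli's inequality (1 - 1/(L+1))^m >= 1 - m/(L+1), cleared of denominators. *)
Lemma bernoulli_pred (L m : nat) : L.+1 ^ m * (L.+1 - m) <= L ^ m * L.+1.
Proof.
elim: m => [|m IHm]; first by rewrite !expn0 subn0.
have step : L.+1 * (L.+1 - m.+1) <= L * (L.+1 - m) by nia.
rewrite !expnS [L.+1 * _]mulnC -mulnA.
apply: leq_trans (leq_mul (leqnn _) step) _.
by rewrite mulnCA -[L * L ^ m * _]mulnA leq_mul.
Qed.

(** With L = m(s+1), Bernoulli bounds (L/(L+1))^m below by 1 - m/(L+1), which exceeds s/(s+1). *)
Lemma ratio_pow_lt (s m : nat) :
  s * (m * s.+1).+1 ^ m < s.+1 * (m * s.+1) ^ m.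
Proof.
set L := m * s.+1; have := bernoulli_pred L m; set a := L.+1 ^ m; set b := L ^ m => ab.
have a_gt0 : 0 < a by rewrite expn_gt0.
have mL : m <= L by rewrite /L; nia.
rewrite -(ltn_pmul2r (ltn0Sn L)) -[_ * b * _]mulnA.
apply: leq_trans (leq_mul (leqnn s.+1) ab).
rewrite -mulnA mulnCA [s.+1 * _]mulnCA ltn_pmul2l //.
by rewrite mulnBr [s.+1 * m]mulnC -/L; nia.
Qed.

(** A Følner property: enlarging both sides of the box costs a factor below (s+1)/s. The second side
    is chosen after [N], since its increment is exponential in [N]; both sides then grow by the
    ratio (L+1)/L. *)
Lemma folner_box (s D k : nat) : 0 < D ->
  exists N U, s * ((N + D) * (U + 2 ^ (N + D))) ^ k < s.+1 * (N * U) ^ k.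
Proof.
move=> D_gt0; pose L := (2 * k) * s.+1; pose N := D * L.
pose T := 2 ^ (N + D); exists N, (L * T).
have -> : (N + D) * (L * T + T) = (D * T) * L.+1 ^ 2.
  by rewrite /N -mulSnr -[D * L + D]mulnSr -mulnn; nia.
have -> : N * (L * T) = (D * T) * L ^ 2 by rewrite /N -mulnn; nia.
rewrite ![(D * T * _) ^ _]expnMn -!expnM -/L mulnCA [ltnRHS]mulnCA.
rewrite ltn_pmul2l ?expn_gt0 ?muln_gt0 ?D_gt0 ?expn_gt0 //.
exact: ratio_pow_lt.
Qed.

Lemma ex_argmax (T : eqType) (S : seq T) (f : T -> nat) : S != [::] ->
  exists2 x, x \in S & {in S, forall y, f y <= f x}.
Proof.
elim: S => // x [_ _|y S /(_ isT)[z zS zmax] _].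
  by exists x; rewrite ?mem_head // => y; rewrite inE => /eqP->.
have [xz|zx] := leqP (f x) (f z).
  by exists z; [by rewrite mem_behead | move] => t; rewrite in_cons => /predU1P[->|/zmax].
exists x; rewrite ?mem_head // => t; rewrite in_cons => /predU1P[->//|/zmax tz].
exact: leq_trans tz (ltnW zx).
Qed.

End Counting.

(** * Linear dependence and sums over tuples *)

Lemma left_dependent (F : fieldType) (T1 T2 : finType) (f : T1 -> T2 -> F) :
  (#|T2| < #|T1|)%N ->
  exists c : T1 -> F,
    (exists t, c t != 0) /\ forall t2, \sum_t1 c t1 * f t1 t2 = 0.
Proof.
move=> lt21.
pose A := \matrix_(i < #|T1|, j < #|T2|) f (enum_val i) (enum_val j).
have /rowV0Pn[v /sub_kermxP vA v0] : kermx A != 0.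
  rewrite kermx_eq0; apply: contraL lt21 => /eqP rA.
  by rewrite -leqNgt -rA rank_leq_col.
have [i vi] : exists i, v 0 i != 0.
  by apply/existsP; apply: contraNT v0 => /existsPn vn; apply/eqP/rowP => i;
     rewrite mxE; apply/eqP; rewrite -[_ == _]negbK vn.
exists (fun t => v 0 (enum_rank t)); split.
  by exists (enum_val i); rewrite enum_valK.
move=> t2; have /rowP/(_ (enum_rank t2)) := vA; rewrite !mxE => e.
rewrite -[RHS]e (reindex (@enum_val T1 T1)) /=; last first.
  by apply: onW_bij; exact: enum_val_bij.
by apply: eq_bigr => j _; rewrite mxE enum_valK enum_rankK.
Qed.

Lemma sum_tupleS (X : finType) (V : nmodType) (l : nat) (f : seq X -> V) :
  \sum_(u : l.+1.-tuple X) f u = \sum_x \sum_(u : l.-tuple X) f (x :: u).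
Proof.
rewrite pair_big /=.
rewrite (reindex (fun p : X * l.-tuple X => [tuple of p.1 :: p.2])) //=.
exists (fun u : l.+1.-tuple X => (thead u, [tuple of behead u])) => [[x u]|u] _ /=.
  by congr pair; apply: val_inj.
by rewrite [u in RHS]tuple_eta.
Qed.

Lemma sum_tuple_cat (X : finType) (V : nmodType) (m n : nat) (f : seq X -> V) :
  \sum_(u : (m + n).-tuple X) f u =
  \sum_(u : m.-tuple X) \sum_(v : n.-tuple X) f (u ++ v).
Proof.
elim: m f => [|m IHm] f.
  rewrite (big_pred1 [tuple]) // => u; exact/esym/eqP/tuple0.
rewrite (sum_tupleS _ f).
rewrite (sum_tupleS _ (fun u => \sum_(v : n.-tuple X) f (u ++ v))).
by apply: eq_bigr => x _; rewrite (IHm (fun u => f (x :: u))).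
Qed.

(** * The ambient monoid *)

Section Ambient.
Variable P : finType.
Local Open Scope nat_scope.

Definition shift := {ffun P -> nat * nat}.
Implicit Types a b t y z : shift.

(* Coordinatewise composition law of the affine maps x |-> u + 2 ^ v * x,
   stored as (v, u). *)
Definition smul a t : shift :=
  [ffun p => ((a p).1 + (t p).1, (a p).2 + 2 ^ (a p).1 * (t p).2)].

Definition sone : shift := [ffun => (0, 0)].

Lemma smulA : associative smul.
Proof.
by move=> a b t; apply/ffunP => p; rewrite !ffunE /= addnA expnD mulnDr addnA mulnA.
Qed.

Lemma smul1 a : smul sone a = a.
Proof. by apply/ffunP => p; rewrite !ffunE /= mul1n; case: (a p). Qed.

Lemma smulI : right_injective smul.
Proof.
move=> a s t /ffunP e; apply/ffunP => p; have := e p; rewrite !ffunE.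
case: (s p) (t p) => [v u] [v' u'] /= [/addnI -> /addnI /eqP].
by rewrite eqn_pmul2l ?expn_gt0 // => /eqP->.
Qed.

Lemma smulIr : left_injective smul.
Proof.
move=> t a b /ffunP e; apply/ffunP => p; have := e p; rewrite !ffunE.
by case: (a p) (b p) => [v u] [v' u'] /= [/addIn -> /addIn ->].
Qed.

(** One round of the selection behind unique products: the fibre over the lexicographic maximum at
    [p] is nonempty, so the next coordinate can be treated inside it. *)
Lemma lex_max_fiber (p : P) (S : seq shift) : S != [::] -> exists v u,
  exists S' : seq shift, [/\ S' != [::], {subset S' <= S},
    {in S', forall a, a p = (v, u)},
    {in S, forall a, (a p).1 <= v /\ ((a p).1 = v -> (a p).2 <= u)} &
    {in S, forall a, a p = (v, u) -> a \in S'}].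
Proof.
move=> S0; have [a aS amax] := ex_argmax (fun a : shift => (a p).1) S0.
pose S1 := [seq b : shift <- S | (b p).1 == (a p).1].
have aS1 : a \in S1 by rewrite mem_filter eqxx.
have S10 : S1 != [::] by apply: contraTneq aS1 => ->.
have [b] := ex_argmax (fun a : shift => (a p).2) S10.
rewrite mem_filter => /andP[/eqP bv bS] bmax.
exists (a p).1, (b p).2, [seq c : shift <- S | c p == ((a p).1, (b p).2)]; split.
- suff: b \in [seq c : shift <- S | c p == ((a p).1, (b p).2)].
    by apply: contraTneq => ->.
  by rewrite mem_filter bS -bv -surjective_pairing eqxx.
- by move=> c; rewrite mem_filter => /andP[].
- by move=> c; rewrite mem_filter => /andP[/eqP].
- move=> c cS; split; first exact: amax.
  by move=> cv; apply: bmax; rewrite mem_filter cv eqxx.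
- by move=> c cS ce; rewrite mem_filter ce eqxx.
Qed.

(* Keeping the elements with largest v and then largest u at one coordinate
   after the other leaves a product that factors in only one way. *)
Lemma unique_product_on (r : seq P) (A T : seq shift) : A != [::] -> T != [::] ->
  exists a0 t0, [/\ a0 \in A, t0 \in T &
    {in A & T, forall a t, {in r, forall p, smul a t p = smul a0 t0 p} ->
                 {in r, forall p, a p = a0 p /\ t p = t0 p}}].
Proof.
elim: r A T => [|p r IHr] A T A0 T0.
  case: A T A0 T0 => [//|a A] [//|t T] _ _.
  by exists a, t; rewrite !mem_head; split.
have [v [u [A' [A'0 A'A A'vu Amax AA']]]] := lex_max_fiber p A0.
have [v' [u' [T' [T'0 T'T T'vu Tmax TT']]]] := lex_max_fiber p T0.
have [a0 [t0 [a0A t0T uniq0]]] := IHr A' T' A'0 T'0.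
exists a0, t0; split; [exact: A'A | exact: T'T | move=> a t aA tT e].
have [ap tp] : a p = (v, u) /\ t p = (v', u').
  have := e p (mem_head _ _); rewrite !ffunE (A'vu a0) // (T'vu t0) //=.
  have := Tmax t tT; have := Amax a aA.
  case: (a p) (t p) => [va ua] [vt ut] /= [hv hu] [hv' hu'] [e1 e2].
  (* Exponents add, so reaching the sum of the maxima forces both to be maximal. With the exponent
     fixed at [v], the second component is increasing in [ua] and [ut], and the same argument
     applies. *)
  have ev : va = v by lia.
  have ev' : vt = v' by lia.
  have := hu ev; have := hu' ev'; rewrite ev ev' in e2 * => lt lu.
  have lm : 2 ^ v * ut <= 2 ^ v * u' by rewrite leq_mul.
  have eu : ua = u by lia.
  have /eqP : 2 ^ v * ut = 2 ^ v * u' by lia.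
  by rewrite eqn_pmul2l ?expn_gt0 // eu => /eqP ->.
have r_eq := uniq0 a t (AA' a aA ap) (TT' t tT tp)
  (fun q qr => e q (mem_behead (s := p :: r) qr)).
move=> q; rewrite inE => /predU1P[->|]; last exact: r_eq.
by rewrite ap tp (A'vu a0) ?(T'vu t0).
Qed.

Lemma unique_product (A T : seq shift) : A != [::] -> T != [::] ->
  exists a0 t0, [/\ a0 \in A, t0 \in T &
    {in A & T, forall a t, smul a t = smul a0 t0 -> a = a0 /\ t = t0}].
Proof.
move=> A0 T0; have [a0 [t0 [aA tT u]]] := unique_product_on (enum P) A0 T0.
exists a0, t0; split=> // a t aA' tT' e.
have at_eq := u a t aA' tT' (fun p _ => congr1 (fun f : shift => f p) e).
by split; apply/ffunP => p; have [] := at_eq p (mem_enum _ p).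
Qed.

Definition box (N U : nat) := {ffun P -> 'I_N * 'I_U}.

Definition of_box N U (b : box N U) : shift :=
  [ffun p => ((b p).1 : nat, (b p).2 : nat)].

Lemma of_box_inj N U : injective (@of_box N U).
Proof.
move=> b b' /ffunP e; apply/ffunP => p; have := e p; rewrite !ffunE.
by case: (b p) (b' p) => [v u] [v' u'] /= [/val_inj -> /val_inj ->].
Qed.

Lemma mem_box N U y : (forall p, (y p).1 < N /\ (y p).2 < U) ->
  exists b : box N U, of_box b = y.
Proof.
move=> yb; exists [ffun p => (Ordinal (yb p).1, Ordinal (yb p).2)].
by apply/ffunP => p; rewrite !ffunE /= -surjective_pairing.
Qed.

Lemma card_box N U : #|{: box N U}| = (N * U) ^ #|P|.
Proof. by rewrite card_ffun card_prod !card_ord. Qed.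

End Ambient.

(** * Words as elements of the ambient monoid *)

Section Words.
Variables (X : finType) (I : rel X).
Local Open Scope nat_scope.
Implicit Types (x y : X) (u w : seq X).

(* The coordinate (a, b) records the projection of a word to {a, b}: its length
   and, as the bits of a number, first letter lowest, the positions of a.  Pairs of distinct
   commuting letters carry no information. *)
Definition letter x : shift (X * X)%type :=
  [ffun p => if I p.1 p.2 && (p.1 != p.2) then (0, 0)
             else (nat_of_bool ((x == p.1) || (x == p.2)), nat_of_bool (x == p.1))].

Definition code w : shift (X * X)%type :=
  foldr (fun x => smul (letter x)) (sone _) w.

Lemma code_cons x w : code (x :: w) = smul (letter x) (code w).
Proof. by []. Qed.

Lemma code_cat u w : code (u ++ w) = smul (code u) (code w).
Proof. by elim: u => [|x u IHu] /=; rewrite ?smul1 // IHu smulA. Qed.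

(** The second component is a binary number with as many digits as the first component says. *)
Lemma code_bound w p :
  (code w p).1 <= size w /\ (code w p).2 < 2 ^ (code w p).1.
Proof.
elim: w => [|x w [IH1 IH2]]; first by rewrite ffunE.
rewrite code_cons !ffunE /=; case: (code w p) IH1 IH2 => v t /= le_v lt_t.
case: ifP => _ /=; first by rewrite !add0n mul1n leqW.
case: (x == p.1); case: (x == p.2); rewrite /= ?add0n ?add1n ?expnS ?muln1 ?mul1n;
by move: (2 ^ v) lt_t => e; lia.
Qed.

Lemma smul_box_code N U D (v : box (X * X)%type N U) w : size w <= D ->
  exists v' : box (X * X)%type (N + D) (U + 2 ^ (N + D)),
    of_box v' = smul (of_box v) (code w).
Proof.
move=> wD; apply: mem_box => p; rewrite !ffunE /=; have [] := code_bound w p.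
case: (code w p) (v p) => n m [[i ltiN] [j ltjU]] /= n_w lt_m.
have le_nD := leq_trans n_w wD; split; first by rewrite -addSn leq_add.
rewrite -addSn leq_add //; apply: (@leq_trans (2 ^ i * 2 ^ n)).
  by rewrite leq_mul // ltnW.
by rewrite -expnD leq_exp2l // leq_add // ltnW.
Qed.

(** Distinct commuting letters never both occur in a recorded pair, so at each coordinate one of the
    two factors is the identity. *)
Lemma letterC x y : symmetric I -> I x y ->
  smul (letter x) (letter y) = smul (letter y) (letter x).
Proof.
move=> Isym Ixy; apply/ffunP => -[a b]; rewrite !ffunE /=.
have [//|] := ifP; have [->//|nxy act] := eqVneq x y.
have apart c d : ~~ (I c d && (c != d)) -> ~~ ((x == c) && (y == d)).
  by apply: contra => /andP[/eqP <- /eqP <-]; rewrite Ixy.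
have := apart a b (negbT act); have : ~~ ((x == b) && (y == a)).
  by apply: apart; rewrite Isym eq_sym act.
have same c : ~~ ((x == c) && (y == c)).
  by apply: contra nxy => /andP[/eqP -> /eqP ->].
move: (same a) (same b).
by case: (x == a); case: (x == b); case: (y == a); case: (y == b).
Qed.

Lemma trace_eq_code u w : symmetric I -> trace_eq I u w -> code u = code w.
Proof.
move=> Isym; elim=> {u w}
  [u w [p [q [x [y [Ixy [-> ->]]]]]]|//|u w _ ->//|u v w _ -> _ ->//].
by rewrite !code_cat !code_cons !smulA -!(smulA (code p)) letterC.
Qed.

Lemma trace_eq_cons x u w : trace_eq I u w -> trace_eq I (x :: u) (x :: w).
Proof.
elim=> {u w} [u w [p [q [a [b [Iab [-> ->]]]]]]|u|u w _|u v w _ IH1 _ IH2].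
- by apply: rst_step; exists (x :: p), q, a, b.
- exact: rst_refl.
- exact: rst_sym.
- exact: rst_trans IH1 IH2.
Qed.

Lemma trace_eq_bubble x p q : {in p, forall y, I y x} ->
  trace_eq I (p ++ x :: q) (x :: p ++ q).
Proof.
elim: p => [_|y p IHp Ip]; first exact: rst_refl.
apply: (rst_trans _ _ _ (y :: x :: p ++ q)).
  by apply/trace_eq_cons/IHp => z zp; apply: Ip; rewrite mem_behead.
by apply: rst_step; exists [::], (p ++ q), y, x; rewrite Ip ?mem_head.
Qed.

(** The first letter among [x] and [y] is here [y], and the lowest bit at (x, y) is set only if that
    letter is [x]. *)
Lemma code_even x y p q : x \notin p -> y \in p -> ~~ I x y ->
  ~~ odd (code (p ++ q) (x, y)).2.
Proof.
move=> + + nI; elim: p => // z p IHp; rewrite !in_cons negb_or => /andP[xz xp] yp.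
rewrite cat_cons code_cons !ffunE /= (negPf nI) /= [z == x]eq_sym (negPf xz) /=.
have [_|zy] := eqVneq z y; first by rewrite mul2n odd_double.
by rewrite mul1n IHp //; move: yp; rewrite eq_sym (negPf zy).
Qed.

(** Induction on [w]: its first letter [x] occurs in [u], commutes with everything before its first
    occurrence there, and so can be moved to the front and cancelled. *)
Lemma code_trace_eq u w : reflexive I -> symmetric I -> code u = code w ->
  trace_eq I u w.
Proof.
move=> Irefl Isym; elim: w u => [|x w IHw] u.
  case: u => [_|y u /ffunP/(_ (y, y))]; first exact: rst_refl.
  by rewrite code_cons !ffunE /= eqxx andbF.
(* The diagonal coordinate (x, x) counts the occurrences of [x]. *)
move=> e; have xu : x \in u.
  have /(congr1 (fun z : shift _ => (z (x, x)).1)) := e.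
  rewrite code_cons !ffunE /= eqxx andbF /=; apply: contra_eqT => xu.
  suff -> : (code u (x, x)).1 = 0 by [].
  elim: u xu {e} => [|z u IHu]; first by rewrite ffunE.
  rewrite in_cons negb_or eq_sym => /andP[/negPf zx /IHu xu].
  by rewrite code_cons !ffunE /= eqxx andbF zx.
pose p := take (index x u) u; pose q := drop (index x u).+1 u.
have u_eq : u = p ++ x :: q by rewrite -(drop_index xu) cat_take_drop.
have xp : x \notin p by rewrite in_take ?ltnn.
rewrite {}u_eq in e *.
have pI : {in p, forall y, I y x}.
  move=> y yp; rewrite Isym; apply: contraT => nI.
  have := code_even (x :: q) xp yp nI; rewrite e code_cons !ffunE /= (negPf nI) /=.
  by rewrite eqxx /= mul2n odd_double.
have pq := trace_eq_bubble q pI; apply: (rst_trans _ _ _ _ _ pq).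
apply/trace_eq_cons/IHw/(@smulI _ (letter x)).
by rewrite -!code_cons -(trace_eq_code Isym pq).
Qed.

End Words.

(** * Propagation of vanishing *)

Section Transfer.
Variables (F : fieldType) (X : finType) (I : rel X) (s : nat).
Variables (a : 'rV[F]_s) (A : X -> 'M[F]_s) (b : 'cV[F]_s).
Notation Y := (shift (X * X)%type).
Notation code := (code I).

Definition word_mx (w : seq X) : 'M[F]_s :=
  foldr (fun x => mulmx (A x)) 1%:M w.

Lemma word_mx_cat u w : word_mx (u ++ w) = word_mx u *m word_mx w.
Proof. by elim: u => [|x u IHu] /=; rewrite ?mul1mx // IHu mulmxA. Qed.

Definition weight (w : seq X) : F := (a *m word_mx w *m b) 0 0.

(** The coefficient at [z] of a M^l b, where M is the sum of the [A x] times [letter x]. *)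
Definition coef (l : nat) (z : Y) : F := \sum_(u : l.-tuple X | code u == z) weight u.

Lemma sum_code_translate (V : nmodType) (f : seq X -> V) l (c z : Y) :
  \sum_(u : l.-tuple X | smul c (code u) == smul c z) f u =
  \sum_(u : l.-tuple X | code u == z) f u.
Proof. by apply: eq_bigl => u; rewrite (inj_eq (@smulI _ c)). Qed.

(** A nonempty sum provides a left quotient of [y] by [c], and cancellation makes it unique. *)
Lemma coef_translate l (c y : Y) :
  \sum_(u : l.-tuple X | smul c (code u) == y) weight u != 0 ->
  exists2 z, smul c z = y &
    \sum_(u : l.-tuple X | smul c (code u) == y) weight u = coef l z.
Proof.
move=> n0; have [u /eqP e] : exists u : l.-tuple X, smul c (code u) == y.
  by apply/existsP; apply: contraNT n0 => /existsPn nu; rewrite big_pred0 // => u;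
     apply/negbTE.
by exists (code u) => //; rewrite -e (sum_code_translate weight).
Qed.

(* s + 1 vectors are dependent in a space of rank s over the monoid algebra of
   [shift]: multiplying by words of length at most s enlarges a suitable box by
   a factor less than (s + 1) / s. *)
Lemma krylov_dependent : exists N U (c : 'I_s.+1 * box (X * X)%type N U -> F),
  (exists t, c t != 0) /\
  forall y : Y, \sum_t c t *: \sum_(u : t.1.-tuple X |
    smul (of_box t.2) (code u) == y) (a *m word_mx u) = 0.
Proof.
(* Lengths up to [s] occur; [s.+1] is taken because [folner_box] asks for a positive increment. *)
have [N [U lt_card]] := folner_box s #|{: X * X}| (ltn0Sn s).
exists N, U; set N' := (N + s.+1)%N in lt_card; set U' := (U + _)%N in lt_card.
(* Unknowns: a power of M and a point of the small box. Equations: a point of the enlarged box and a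
   vector component. *)
pose f (t : 'I_s.+1 * box (X * X)%type N U) (r : box (X * X)%type N' U' * 'I_s) : F :=
  (\sum_(u : t.1.-tuple X | smul (of_box t.2) (code u) == of_box r.1)
     (a *m word_mx u)) 0 r.2.
have [|c [c0 cf]] := left_dependent f.
  by rewrite !card_prod !card_box !card_ord mulnC.
exists c; split=> // y.
have [/existsP[y' /eqP <-]|ny] :=
    boolP [exists y' : box (X * X)%type N' U', of_box y' == y].
  by apply/rowP => q; rewrite summxE mxE -[RHS](cf (y', q));
     apply: eq_bigr => t _; rewrite mxE.
rewrite big1 // => -[i v] _; rewrite big_pred0 ?scaler0 // => u.
apply: contraNF ny => /eqP <-; apply/existsP.
have [|y' <-] := smul_box_code I (D := s.+1) v (w := u); last by exists y'.
by rewrite size_tuple ltnW.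
Qed.

Lemma coef_eq0 (l : nat) (z : Y) :
  (forall l z, (l < s)%N -> coef l z = 0) -> coef l z = 0.
Proof.
move=> short; elim/ltn_ind: l z => k IHk z; have [ks|sk] := ltnP k s.
  exact: short.
have [N [U [c [c0 cP]]]] := krylov_dependent.
(* The dependence multiplied on the right by M^n b. For each tail [w] of length [n], either [y] has
   no right quotient by [code w] and no term survives, or the relation at that quotient applies. *)
have shifted n (y : Y) : \sum_t c t * \sum_(u : (t.1 + n).-tuple X |
    smul (of_box t.2) (code u) == y) weight u = 0.
  under eq_bigr => t _.
    rewrite big_mkcond (sum_tuple_cat _ _ (fun u : seq X =>
      if smul (of_box t.2) (code u) == y then weight u else 0)).
    rewrite exchange_big mulr_sumr; over.
  rewrite exchange_big big1 //= => w _.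
  have [[y' y'w]|ny] :=
      excluded_middle_informative (exists y', smul y' (code w) = y); last first.
    rewrite big1 // => t _; rewrite big1 ?mulr0 // => u _.
    case: eqP => // e; case: ny; exists (smul (of_box t.2) (code u)).
    by rewrite -e code_cat smulA.
  pose d := word_mx w *m b.
  transitivity (((\sum_t c t *: \sum_(u : t.1.-tuple X |
    smul (of_box t.2) (code u) == y') (a *m word_mx u)) *m d) 0 0); last first.
    by rewrite cP mul0mx mxE.
  rewrite mulmx_suml summxE; apply: eq_bigr => t _.
  rewrite -scalemxAl mulmx_suml mxE summxE -big_mkcond; congr (_ * _).
  apply: eq_big => u; first by rewrite -y'w code_cat smulA (inj_eq (@smulIr _ _)).
  by rewrite /weight word_mx_cat /d !mulmxA.
have [t1 t1P] := c0.
have [j /existsP[v0 cj0] jmax] : exists2 j : 'I_s.+1, [exists v, c (j, v) != 0]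
    & forall i : 'I_s.+1, (j < i)%N -> forall v, c (i, v) = 0.
  have P0 : [exists v, c (t1.1, v) != 0].
    by apply/existsP; exists t1.2; rewrite -surjective_pairing.
  case: (@arg_maxnP _ t1.1 (fun i => [exists v, c (i, v) != 0]) val P0) => j Pj jmax.
  exists j => // i ji v; apply/eqP; apply: contraLR ji => civ; rewrite -leqNgt.
  by apply: jmax; apply/existsP; exists v.
have jk : (j <= k)%N by apply: leq_trans sk; rewrite -ltnS.
(* Take n = k - j: the coefficients with index above [j] vanish, and those below [j] meet words
   shorter than [k], covered by induction. *)
have top y : \sum_v c (j, v) * \sum_(u : k.-tuple X |
    smul (of_box v) (code u) == y) weight u = 0.
  rewrite -[RHS](shifted (k - j)%N y).
  transitivity (\sum_(i < s.+1) \sum_v c (i, v) * \sum_(u : (i + (k - j)).-tuple X |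
      smul (of_box v) (code u) == y) weight u); last first.
    by rewrite pair_bigA; apply: eq_bigr => -[].
  rewrite (bigD1 j) //= [X in _ + X]big1 ?addr0 ?subnKC // => i ij.
  rewrite big1 // => v _; have [ji|] := ltnP j i; first by rewrite jmax ?mul0r.
  rewrite leq_eqVlt val_eqE (negPf ij) /= => lt_ij.
  case: eqP (@coef_translate (i + (k - j)) (of_box v) y) => [-> _|_ [] // z' _ ->].
    by rewrite mulr0.
  by rewrite IHk ?mulr0 // -[ltnRHS](subnKC jk) ltn_add2r.
apply/eqP/negPn/negP => kz0.
(* No zero divisors: [T] contains the support of [coef k], [B] that of c_j. At a uniquely factored
   product of [B] and [T], a single nonzero term of [top] remains. *)
pose T := [seq z' <- [seq code u | u : k.-tuple X] | coef k z' != 0].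
have coefT z' : coef k z' != 0 -> z' \in T.
  move=> n0; rewrite mem_filter n0; move: n0; apply: contraNT => /imageP nz.
  by rewrite /coef big_pred0 // => u; apply/eqP => e; apply: nz; exists u.
pose B := [seq of_box v | v <- enum {: box (X * X)%type N U} & c (j, v) != 0].
have T0 : T != [::] by apply: contraTneq (coefT z kz0) => ->.
have memB v : c (j, v) != 0 -> of_box v \in B.
  by move=> cv; rewrite map_f // mem_filter cv mem_enum.
have B0 : B != [::] by apply: contraTneq (memB v0 cj0) => ->.
have [b0 [t0 [/mapP[w0 + ->] t0T uniq0]]] := unique_product B0 T0.
rewrite mem_filter => /andP[cw0 _].
have := top (smul (of_box w0) t0).
rewrite (bigD1 w0) //= [X in _ + X]big1 ?addr0 => [/eqP|v vw].
  rewrite (sum_code_translate weight) mulf_eq0 (negPf cw0) /=.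
  by move: t0T; rewrite mem_filter => /andP[/negPf]; rewrite /coef => ->.
have [->|cv] := eqVneq (c (j, v)) 0; first by rewrite mul0r.
case: eqP (@coef_translate k (of_box v) (smul (of_box w0) t0)) => [->|/eqP n0 []//].
  by rewrite mulr0.
move=> t e et; rewrite et in n0.
have [/of_box_inj vw0 _] := uniq0 _ _ (memB v cv) (coefT t n0) e.
by rewrite vw0 eqxx in vw.
Qed.

End Transfer.

(** * Path sums as matrix products *)

Section Automaton.
Variables (F : fieldType) (X Q : finType) (E : Q -> X -> Q -> F) (tau : Q -> F).

Lemma word_weight_nil (iota : Q -> F) :
  word_weight iota E tau [::] = \sum_q iota q * tau q.
Proof.
rewrite /word_weight (reindex (fun q : Q => [ffun _ : 'I_1 => q])) /=.
  by apply: eq_bigr => q _; rewrite /path_weight big_ord0 !ffunE mulr1.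
exists (fun f : {ffun 'I_1 -> Q} => f ord0) => [q|f] _; first by rewrite ffunE.
by apply/ffunP => i; rewrite ffunE (ord1 i).
Qed.

(** Summing out the first state of a path turns the first letter into new initial weights. *)
Lemma word_weight_cons (iota : Q -> F) x w :
  word_weight iota E tau (x :: w) =
  word_weight (fun q' => \sum_q iota q * E q x q') E tau w.
Proof.
pose ext (r : Q * {ffun 'I_(size w).+1 -> Q}) : {ffun 'I_(size w).+2 -> Q} :=
  [ffun i => if unlift ord0 i is Some k then r.2 k else r.1].
have ext0 r : ext r ord0 = r.1 by rewrite ffunE unlift_none.
have extS r k : ext r (lift ord0 k) = r.2 k by rewrite ffunE liftK.
rewrite /word_weight (reindex ext) /=; last first.
  exists (fun f => (f ord0, [ffun k => f (lift ord0 k)])) => [[q f]|f] _.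
    by rewrite ext0; congr pair; apply/ffunP => k; rewrite ffunE extS.
  apply/ffunP => i; rewrite ffunE; case: unliftP => [k ->|->] //=.
  by rewrite ffunE.
rewrite -(pair_bigA _ (fun q f => path_weight iota E tau (w := x :: w) (ext (q, f)))) /=.
rewrite exchange_big; apply: eq_bigr => f _; rewrite /path_weight.
rewrite !mulr_suml; apply: eq_bigr => q _.
rewrite big_ord_recl ext0 -!mulrA; congr (_ * _).
have -> : widen_ord (leqnSn (size w).+1) ord0 = ord0 by apply: val_inj.
rewrite ext0 extS; congr (_ * (_ * _)).
  apply: eq_bigr => i _.
  have -> : widen_ord (leqnSn (size w).+1) (lift ord0 i) =
            lift ord0 (widen_ord (leqnSn (size w)) i) by apply: val_inj.
  by rewrite !extS !(tnth_nth x).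
have -> : ord_max = lift ord0 (ord_max : 'I_(size w).+1) by apply: val_inj.
by rewrite extS.
Qed.

Lemma word_weight_mx (iota : Q -> F) w :
  word_weight iota E tau w =
  weight (\row_(i < #|Q|) iota (enum_val i))
         (fun x => \matrix_(i, k) E (enum_val i) x (enum_val k))
         (\col_(k < #|Q|) tau (enum_val k)) w.
Proof.
have sum_Q (f : Q -> F) : \sum_q f q = \sum_(k < #|Q|) f (enum_val k).
  by rewrite (reindex (@enum_val Q Q)) //; apply: onW_bij; exact: enum_val_bij.
elim: w iota => [|x w IHw] iota.
  rewrite word_weight_nil sum_Q /weight mulmx1 mxE.
  by apply: eq_bigr => k _; rewrite !mxE.
rewrite word_weight_cons IHw /weight /= !mulmxA; congr ((_ *m _ *m _) 0 0).
apply/rowP => k; rewrite !mxE sum_Q; apply: eq_bigr => i _.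
by rewrite !mxE.
Qed.

End Automaton.

(** * The length bound *)

Theorem theorem10 :
  exists C : nat,
  forall (F : fieldType) (X : finType) (I : rel X),
    reflexive I -> symmetric I ->
  forall (Q : finType) (iota : Q -> F) (E : Q -> X -> Q -> F) (tau : Q -> F),
    (exists w : seq X, series_coef iota E tau I w != 0) <->
    (exists w : seq X,
        (size w <= C * #|X| ^ 3 * #|Q| ^ 2)%N /\ series_coef iota E tau I w != 0).
Proof.
exists 1%N => F X I Irefl Isym Q iota E tau; split=> [[w w_neq0]|[w [_ w_neq0]]];
  last by exists w.
(* For an empty alphabet the bound is 0, and the only word is empty. Otherwise a length below [#|Q|]
   lies within the bound. *)
rewrite mul1n; case: (posnP #|X|) => [X0|X_gt0].
  exists w; split=> //; case: w {w_neq0} => // x w.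
  by have := card0_eq X0 x; rewrite inE.
pose a := \row_(i < #|Q|) iota (enum_val i).
pose A x := \matrix_(i < #|Q|, k < #|Q|) E (enum_val i) x (enum_val k).
pose b := \col_(k < #|Q|) tau (enum_val k).
(* Among words of the same length, the trace class of [u] is the fibre of [code] through [u]. *)
have coefE u : series_coef iota E tau I u = coef I a A b (size u) (code I u).
  apply: eq_big => v; last by rewrite word_weight_mx.
  rewrite /trace_eqb; case: excluded_middle_informative => uv.
    by rewrite (trace_eq_code Isym uv) eqxx.
  by apply/esym/eqP => vu; apply/uv/code_trace_eq.
have [/existsP[l /existsP[u u_neq0]]|no_short] :=
  boolP [exists l : 'I_#|Q|, exists u : l.-tuple X, coef I a A b l (code I u) != 0].
  exists u; rewrite coefE size_tuple; split=> //.
  apply: leq_trans (ltnW (ltn_ord l)) _; rewrite -mulnn mulnA leq_pmull //.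
  by rewrite muln_gt0 expn_gt0 X_gt0 (leq_ltn_trans _ (ltn_ord l)).
case/eqP: w_neq0; rewrite coefE; apply: coef_eq0 => l z lQ.
apply/eqP; apply: contraNT no_short => z_neq0; apply/existsP; exists (Ordinal lQ).
apply: contraNT z_neq0 => /existsPn no_u; rewrite /coef.
(* Vanishing is needed at every [z]; if [z] is not the code of a word of length [l], the sum is
   empty. *)
have [/existsP[u /eqP <-]|nz] := boolP [exists u : l.-tuple X, code I u == z].
  exact: negbNE (no_u u).
by rewrite big_pred0 // => u; apply: contraNF nz => uz; apply/existsP; exists u.
Qed.
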